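(* Let $k\ge 3$ and let $H=(V,E)$ be a hypergraph all of whose hyperedges have size between $2$ and $k$. If the real number $\beta$ satisfies $$-\frac{1}{2^{k-1}-1}\le\beta\le\frac{1}{2^{k-1}\cos^{k-1}\!\left(\frac{\pi}{k-1}\right)+1},$$ then every complex zero of the polynomial $\lambda\mapsto Z_H^{\beta}(\lambda)$ lies on the unit circle $\{|\lambda|=1\}$. Conversely, if $\beta\neq 1$ is a real number not in this range, then there exists a hypergraph $H$ with all hyperedges of size at most $k$ such that some zero of $Z_H^{\beta}(\lambda)$ does not lie on the unit circle.
   Context: For a hypergraph $H=(V,E)$ (hyperedges are subsets of $V$), edge activity $\beta\in\mathbb R$ and $\lambda\in\mathbb C$, the Ising partition function is $Z_H^{\beta}(\lambda)=\sum_{S\subseteq V}\beta^{|E(S,\overline S)|}\lambda^{|S|}$, where $E(S,\overline S)$ is the set of hyperedges containing at least one vertex of $S$ and at least one vertex of $V\setminus S$. *)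

(* Defs.v *)
From mathcomp Require Import all_boot.
From Stdlib Require Import Reals.

Set Implicit Arguments.
Unset Strict Implicit.
Unset Printing Implicit Defensive.

Record Cplx := mkC { Re : R; Im : R }.

Definition C0 : Cplx := mkC 0%R 0%R.
Definition C1 : Cplx := mkC 1%R 0%R.
Definition Cadd (z w : Cplx) : Cplx := mkC (Re z + Re w)%R (Im z + Im w)%R.
Definition Cmul (z w : Cplx) : Cplx :=
  mkC (Re z * Re w - Im z * Im w)%R (Re z * Im w + Im z * Re w)%R.
Definition Cscale (a : R) (z : Cplx) : Cplx := mkC (a * Re z)%R (a * Im z)%R.
Fixpoint Cpow (z : Cplx) (m : nat) : Cplx :=
  match m with O => C1 | S m' => Cmul z (Cpow z m') end.
Definition Cnorm2 (z : Cplx) : R := (Re z * Re z + Im z * Im z)%R.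

Definition cut_edges (n : nat) (E : {set {set 'I_n}}) (S : {set 'I_n}) :
  {set {set 'I_n}} :=
  [set e in E | (e :&: S != set0) && (e :\: S != set0)].

Definition Zising (n : nat) (E : {set {set 'I_n}}) (beta : R) (lam : Cplx) : Cplx :=
  foldr (fun S acc => Cadd (Cscale (beta ^ #|cut_edges E S|)%R (Cpow lam #|S|)) acc)
        C0 (enum [set: {set 'I_n}]).

Definition beta_lo (k : nat) : R := (- / (2 ^ (k - 1) - 1))%R.
Definition beta_hi (k : nat) : R :=
  (/ (2 ^ (k - 1) * (cos (PI / INR (k - 1))) ^ (k - 1) + 1))%R.

(* Main.v *)
Require Import Defs.
From Stdlib Require Import Reals Lra Lia.

(* Forward direction: the multivariate Lee-Yang property (no zero with all
   [|z_i| < 1]) is stable under coefficientwise product (Asano contraction), so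
   it suffices to prove it for one hyperedge.  There the polynomial is affine in
   each variable, [A + z B], with
     [A = 1 - b + b * prod (1 + z_i)],
     [B = (1 - b) * prod z_i + b * prod (1 + z_i)]
   over the at most [k - 1] other variables.  On the torus [|B| = |A|], so by the
   maximum principle [|B| <= |A|] on the polydisc once [A] has no zero there.
   A zero of [A] makes a product of [k - 1] points of the disc [|x - 1| < 1] equal
   to [-(1 - b) / b]; such a product has modulus less than [2 ^ (k - 1)], and when
   it is negative its arguments add up to at least [pi], whence, by concavity of
   [ln cos], it has modulus at most [(2 cos (pi / (k - 1))) ^ (k - 1)].  Zeros
   outside the disc are excluded by the symmetry [S <-> ~: S].

   Converse: a single hyperedge always suffices, of size [2] if [1 < b] and of
   size [k] otherwise.  Below the range the polynomial changes sign on [(0, 1)];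
   between the upper bound and [1] the Cayley transform turns it into a
   real polynomial with a positive local minimum, which cannot be real-rooted. *)

(** * Products of points of a disc *)

Section RealTrigonometry.
Local Open Scope R_scope.

(* The tangent line at [t] of the concave function [ln cos], exponentiated. *)
Lemma cos_le_tangent (t f : R) : 0 < t < PI / 2 ->
  - (PI / 2) < f < PI / 2 -> cos f * exp (tan t * (f - t)) <= cos t.
Proof.
intros [t0 t1] [f0 f1].
assert (ct : 0 < cos t) by (apply cos_gt_0; lra).
pose (g := fun x => cos x * exp (tan t * (x - t))).
pose (g' := fun x => sin (t - x) / cos t * exp (tan t * (x - t))).
assert (dg : forall x, derivable_pt_lim g x (g' x)).
{ intro x. unfold g, g'.
  replace (sin (t - x) / cos t * exp (tan t * (x - t)))
    with (- sin x * exp (tan t * (x - t))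
          + cos x * (exp (tan t * (x - t)) * (tan t * (1 - 0)))).
  2: { rewrite sin_minus; unfold tan; field; lra. }
  apply (derivable_pt_lim_mult cos (fun y => exp (tan t * (y - t))));
    [apply derivable_pt_lim_cos|].
  apply (derivable_pt_lim_comp (fun y => tan t * (y - t)) exp x
           (tan t * (1 - 0)) (exp (tan t * (x - t)))).
  - apply (derivable_pt_lim_scal (fun y => y - t)).
    apply (derivable_pt_lim_minus (fun y => y) (fun _ => t)).
    + apply derivable_pt_lim_id.
    + apply derivable_pt_lim_const.
  - apply derivable_pt_lim_exp. }
assert (gt : g t = cos t).
{ unfold g; rewrite Rminus_diag, Rmult_0_r, exp_0; ring. }
change (g f <= cos t); rewrite <- gt.
assert (sg : forall x, -(PI/2) < x < PI/2 -> 0 <= g' x * (t - x)).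
{ intros x [x0 x1]; unfold g'.
  replace (sin (t - x) / cos t * exp (tan t * (x - t)) * (t - x))
   with ((sin (t - x) * (t - x)) * (exp (tan t * (x - t)) / cos t)) by (field; lra).
  apply Rmult_le_pos.
  - destruct (Rle_lt_dec x t).
    + apply Rmult_le_pos; [apply sin_ge_0|]; lra.
    + replace (sin (t - x)) with (- sin (x - t))
        by (rewrite <- sin_neg; f_equal; ring).
      assert (0 <= sin (x - t)) by (apply sin_ge_0; lra). nra.
  - apply Rlt_le, Rdiv_lt_0_compat; [apply exp_pos|exact ct]. }
destruct (Rtotal_order f t) as [ft|[ft|ft]].
- destruct (MVT_cor2 g g' f t ft) as [c [e [c0 c1]]]; [intros; apply dg|].
  assert (0 <= g' c * (t - c)) by (apply sg; lra).
  assert (0 <= g' c) by nra. nra.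
- subst; lra.
- destruct (MVT_cor2 g g' t f ft) as [c [e [c0 c1]]]; [intros; apply dg|].
  assert (0 <= g' c * (t - c)) by (apply sg; lra).
  assert (g' c <= 0) by nra. nra.
Qed.

(** The first hypothesis says that $a + ib$ lies in the disc $|x - 1| \le 1$, whose polar equation
    is $r \le 2\cos f$. *)
Lemma disc_polar (a b : R) : a * a + b * b <= 2 * a -> 0 < a ->
  exists r f, 0 < r <= 2 * cos f /\ - (PI / 2) < f < PI / 2 /\
    a = r * cos f /\ b = r * sin f.
Proof.
intros disc a0.
pose (f := atan (b / a)).
destruct (atan_bound (b / a)) as [f0 f1].
assert (cf : 0 < cos f) by (apply cos_gt_0; unfold f; lra).
assert (tf : sin f = b / a * cos f).
{ rewrite <- (tan_atan (b / a)); fold f; unfold tan; field; lra. }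
exists (a / cos f), f; repeat split.
- apply Rdiv_lt_0_compat; lra.
- assert (e : cos f * cos f * (a * a + b * b) = a * a).
  { pose proof (sin2_cos2 f) as h; unfold Rsqr in h; rewrite tf in h.
    replace (a * a) with (a * a * 1) at 2 by ring; rewrite <- h.
    field; lra. }
  apply Rmult_le_reg_r with (cos f); [lra|].
  replace (a / cos f * cos f) with a by (field; lra).
  nra.
- unfold f; lra.
- unfold f; lra.
- field; lra.
- rewrite tf; field; lra.
Qed.

Lemma cos_eq_m1_ge_PI (f : R) : cos f = -1 -> PI <= Rabs f.
Proof.
intro cf; destruct (Rle_lt_dec PI (Rabs f)) as [|lt]; [assumption|exfalso].
assert (c : cos (Rabs f) = -1).
{ unfold Rabs; destruct (Rcase_abs f); [rewrite cos_neg|]; assumption. }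
rewrite <- cos_PI in c.
pose proof (Rabs_pos f).
assert (h := cos_decreasing_1 (Rabs f) PI).
assert (cos PI < cos (Rabs f)) by (apply h; lra). lra.
Qed.

(* What [cos_le_tangent] gives for a product of [n] points of the disc: their
   moduli are at most twice the cosines of their arguments. *)
Definition in_sector (t : R) (n : nat) (a b : R) : Prop :=
  exists r f, 0 < r <= (2 * cos t) ^ n * exp (tan t * (INR n * t - Rabs f)) /\
    a = r * cos f /\ b = r * sin f.

Lemma in_sector1 (t : R) : in_sector t 0 1 0.
Proof.
exists 1, 0; rewrite cos_0, sin_0, Rabs_R0; simpl.
rewrite Rmult_0_l, Rminus_0_r, Rmult_0_r, exp_0; lra.
Qed.

(** Moduli multiply and arguments add. The tangent inequality bounds the new modulus, and the
    triangle inequality handles the new argument. *)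
Lemma in_sector_mul (t : R) (n : nat) (a b c d : R) : 0 < t < PI / 2 ->
  a * a + b * b <= 2 * a -> 0 < a -> in_sector t n c d ->
  in_sector t (S n) (a * c - b * d) (a * d + b * c).
Proof.
intros ht disc a0 [r [f [[r0 rb] [-> ->]]]].
destruct (disc_polar a b disc a0) as [q [g [[q0 qb] [hg [-> ->]]]]].
exists (q * r), (g + f); split; [split|split].
- nra.
- assert (tt : 0 < tan t) by (apply tan_gt_0; lra).
  assert (ct : 0 < cos t) by (apply cos_gt_0; lra).
  assert (q2 : q <= 2 * cos t * exp (tan t * (t - Rabs g))).
  { assert (hc := cos_le_tangent t (Rabs g) ht).
    assert (hg' : - (PI / 2) < Rabs g < PI / 2).
    { pose proof (Rabs_pos g); split; [lra|apply Rabs_def1; lra]. }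
    specialize (hc hg').
    replace (cos (Rabs g)) with (cos g) in hc.
    2: { unfold Rabs; destruct (Rcase_abs g); [rewrite cos_neg|]; reflexivity. }
    assert (inv : exp (tan t * (Rabs g - t)) * exp (tan t * (t - Rabs g)) = 1).
    { rewrite <- exp_plus, <- exp_0; f_equal; ring. }
    pose proof (exp_pos (tan t * (t - Rabs g))) as ep.
    assert (cos g <= cos t * exp (tan t * (t - Rabs g))); [|lra].
    replace (cos g) with
      (cos g * exp (tan t * (Rabs g - t)) * exp (tan t * (t - Rabs g)))
      by (rewrite Rmult_assoc, inv; ring).
    apply Rmult_le_compat_r; lra. }
  apply Rle_trans with ((2 * cos t * exp (tan t * (t - Rabs g))) *
    ((2 * cos t) ^ n * exp (tan t * (INR n * t - Rabs f)))).
  { apply Rmult_le_compat; lra. }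
  rewrite S_INR; simpl.
  replace (2 * cos t * exp (tan t * (t - Rabs g)) *
     ((2 * cos t) ^ n * exp (tan t * (INR n * t - Rabs f))))
  with (2 * cos t * (2 * cos t) ^ n *
     (exp (tan t * (t - Rabs g)) * exp (tan t * (INR n * t - Rabs f)))) by ring.
  apply Rmult_le_compat_l.
  { apply Rmult_le_pos; [lra|apply pow_le; lra]. }
  rewrite <- exp_plus.
  assert (tri := Rabs_triang g f).
  destruct (Rle_lt_or_eq_dec (Rabs (g + f)) (Rabs g + Rabs f) tri) as [lt|e].
  + apply Rlt_le, exp_increasing; nra.
  + right; f_equal; rewrite e; ring.
- rewrite cos_plus; ring.
- rewrite sin_plus; ring.
Qed.

Lemma PI_div_acute (K : nat) : (3 <= K)%nat -> 0 < PI / INR K < PI / 2.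
Proof.
intro K3; pose proof PI_RGT_0 as pi0.
assert (K3' : 3 <= INR K).
{ replace 3 with (INR 3) by (simpl; ring). apply le_INR; assumption. }
split; [apply Rdiv_lt_0_compat; lra|].
apply Rmult_lt_compat_l; [lra|apply Rinv_lt_contravar; lra].
Qed.

(** The argument of a negative real is at least $\pi$ in absolute value, which leaves the bound $P^n
    e^{\tan t\,(nt - \pi)}$ with $P = 2\cos t$. Since $P e^{t\tan t} \ge 1$, it does not decrease
    with $n$, and at $n = K$ the exponent vanishes. *)
Lemma in_sector_negative (K n : nat) (y : R) : (3 <= K)%nat -> (n <= K)%nat ->
  in_sector (PI / INR K) n (- y) 0 -> 0 < y -> y <= (2 * cos (PI / INR K)) ^ K.
Proof.
intros K3 nK [r [f [[r0 rb] [ec es]]]] y0.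
assert (ht := PI_div_acute K K3).
assert (K0 : 0 < INR K) by (apply lt_0_INR; lia).
pose proof PI_RGT_0 as pi0.
set (t := PI / INR K) in *.
assert (tt : 0 < tan t) by (apply tan_gt_0; lra).
assert (ct : 0 < cos t) by (apply cos_gt_0; lra).
assert (sf : sin f = 0) by nra.
assert (cf : cos f = -1).
{ pose proof (sin2_cos2 f) as h; unfold Rsqr in h; rewrite sf in h. nra. }
assert (ry : y = r) by (rewrite cf in ec; lra).
assert (pf := cos_eq_m1_ge_PI f cf).
set (P := 2 * cos t) in *.
assert (base : 1 <= P * exp (tan t * t)).
{ assert (h : 0 < t < PI / 2) by lra.
  assert (h0 : - (PI / 2) < 0 < PI / 2) by lra.
  pose proof (cos_le_tangent t 0 h h0) as hc; rewrite cos_0 in hc.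
  assert (inv : exp (tan t * (0 - t)) * exp (tan t * t) = 1).
  { rewrite <- exp_plus, <- exp_0; f_equal; ring. }
  pose proof (exp_pos (tan t * t)); unfold P; nra. }
assert (P0 : 0 < P) by (unfold P; lra).
assert (powexp : forall m, P ^ m * exp (tan t * (INR m * t)) = (P * exp (tan t * t)) ^ m).
{ induction m.
  - simpl; rewrite Rmult_0_l, Rmult_0_r, exp_0; ring.
  - rewrite S_INR; simpl; rewrite <- IHm.
    replace (tan t * ((INR m + 1) * t)) with (tan t * t + tan t * (INR m * t)) by ring.
    rewrite exp_plus; ring. }
assert (mono := Rle_pow _ n K base nK).
rewrite <- !powexp in mono.
assert (Kt : INR K * t = PI) by (unfold t; field; lra).
rewrite Kt in mono.
rewrite ry; apply Rle_trans with (1 := rb).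
assert (ef : exp (tan t * (INR n * t - Rabs f)) <=
   exp (tan t * (INR n * t)) * exp (- (tan t * PI))).
{ rewrite <- exp_plus.
  destruct (Rle_lt_or_eq_dec _ _ pf) as [lt|e].
  - apply Rlt_le, exp_increasing; nra.
  - right; f_equal; rewrite <- e; ring. }
apply Rle_trans with (P ^ n * (exp (tan t * (INR n * t)) * exp (- (tan t * PI)))).
{ apply Rmult_le_compat_l; [apply pow_le; lra|exact ef]. }
assert (inv : exp (tan t * PI) * exp (- (tan t * PI)) = 1).
{ rewrite <- exp_plus, <- exp_0; f_equal; ring. }
replace (P ^ K) with (P ^ K * exp (tan t * PI) * exp (- (tan t * PI)))
  by (rewrite Rmult_assoc, inv; ring).
rewrite <- Rmult_assoc.
apply Rmult_le_compat_r; [apply Rlt_le, exp_pos|exact mono].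
Qed.

Lemma cos_PI_div_2 : cos (PI / INR 2) = 0.
Proof. simpl; replace (PI / (1 + 1)) with (PI / 2) by field; exact cos_PI2. Qed.

Lemma cos_PI_div_ge0 (K : nat) : (2 <= K)%nat -> 0 <= cos (PI / INR K).
Proof.
intro K2; destruct (Nat.eq_dec K 2) as [->|K3].
- rewrite cos_PI_div_2; lra.
- assert (h := PI_div_acute K ltac:(lia)).
  apply Rlt_le, cos_gt_0; lra.
Qed.

End RealTrigonometry.

From mathcomp Require Import all_boot all_order all_algebra.
From mathcomp Require Import complex Rstruct.
From mathcomp Require Import ring lra.
Set Implicit Arguments.
Unset Strict Implicit.
Unset Printing Implicit Defensive.
Import Order.TTheory GRing.Theory Num.Theory.
Local Open Scope ring_scope.

(** * The Lee-Yang property of multiaffine polynomials *)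

Section ComplexPlane.
Variable C : numClosedFieldType.
Implicit Types (a b c d u v z w : C) (s t : seq C).

(** On the diagonal $z = w$ the quadratic $a + (b + c)r + dr^2$ has no root in the open disc, so for
    $d \ne 0$ the product $a/d$ of its roots has modulus at least 1; but $a + dz = 0$ would make it
    $-z$. *)
Lemma asano_contraction a b c d :
  (forall z w, `|z| < 1 -> `|w| < 1 -> a + b * z + c * w + d * z * w != 0) ->
  forall z, `|z| < 1 -> a + d * z != 0.
Proof.
move=> nz z z1; apply/negP => /eqP e.
have a0 : a != 0.
  by have := nz 0 0; rewrite normr0 ltr01 !mulr0 !addr0; apply.
have d0 : d != 0 by apply: contraNneq a0 => d0; rewrite -e d0 mul0r addr0.
pose D := sqrtC ((b + c) ^+ 2 - 4 * a * d).
have D2 : D ^+ 2 = (b + c) ^+ 2 - 4 * a * d by rewrite sqrtCK.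
pose r1 := (- (b + c) + D) / (2 * d); pose r2 := (- (b + c) - D) / (2 * d).
have root_out (r : C) : (2 * d * r + (b + c)) ^+ 2 = D ^+ 2 -> 1 <= `|r|.
  move=> er; rewrite real_leNgt ?ger0_real // ?ler01 //; apply/negP => r_lt1.
  move/eqP: (nz r r r_lt1 r_lt1); apply.
  have d4 : 4 * d != 0 by rewrite mulf_neq0 ?pnatr_eq0.
  apply: (mulfI d4); rewrite mulr0 -[RHS](subrr (D ^+ 2)) -{1}er D2; ring.
have r1_out : 1 <= `|r1| by apply: root_out; rewrite /r1; field.
have r2_out : 1 <= `|r2| by apply: root_out; rewrite /r2; field.
have r12 : r1 * r2 = - z.
  have -> : r1 * r2 = ((b + c) ^+ 2 - D ^+ 2) / (4 * d ^+ 2).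
    by rewrite /r1 /r2; field.
  have ea : a = - (d * z) by apply/eqP; rewrite -addr_eq0 e.
  by rewrite D2 ea; field.
have := mulr_ege1 r1_out r2_out.
by rewrite -normrM r12 normrN => /le_lt_trans/(_ z1); rewrite ltxx.
Qed.

(* Write [c + d u = p (a + b u) + q (a' u + b')] with [a'], [b'] the conjugates
   of [a], [b].  The quotient by [a + b u] is then [p + q m(u)] with [m] a Möbius
   automorphism of the disc, and the supremum [|p| + |q|] of its modulus is
   attained on the circle. *)
Lemma affine_quotient_max a b c d :
  `|b| < `|a| ->
  (forall u, `|u| = 1 -> `|c + d * u| <= `|a + b * u|) ->
  forall z, `|z| <= 1 -> `|c + d * z| <= `|a + b * z|.
Proof.
move=> ltba circ z z1.
pose D := a * a^* - b * b^*.
have D0 : 0 < D by rewrite /D -!normCK subr_gt0 ltrXn2r.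
have Dn0 := lt0r_neq0 D0.
have [p [q pq]] : exists p q, forall u,
    c + d * u = p * (a + b * u) + q * (a^* * u + b^*).
  exists ((c * a^* - d * b^*) / D), ((a * d - b * c) / D) => u.
  by move: Dn0; rewrite /D => ?; field.
have denom_neq0 u : `|u| <= 1 -> a + b * u != 0.
  move=> u1; rewrite addr_eq0; apply: contraTneq ltba => ->.
  rewrite normrN normrM -real_leNgt ?rpredM ?normr_real //.
  by rewrite ler_piMr.
have pq1 : `|p| + `|q| <= 1.
  have [m m1 <-] : exists2 m : C, `|m| = 1 & `|p + q * m| = `|p| + `|q|.
    have [->|p0] := eqVneq p 0.
      by exists 1; rewrite ?normr1 // mulr1 !add0r normr0 add0r.
    have [->|q0] := eqVneq q 0.
      by exists 1; rewrite ?normr1 // mul0r normr0 !addr0.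
    have np0 : `|p| != 0 by rewrite normr_eq0.
    have nq0 : `|q| != 0 by rewrite normr_eq0.
    exists (p / `|p| * (`|q| / q)).
      by rewrite normrM !normf_div !normr_id !divff // mulr1.
    have -> : p + q * (p / `|p| * (`|q| / q)) = p / `|p| * (`|p| + `|q|).
      by field; rewrite np0 q0.
    rewrite normrM normf_div normr_id divff // mul1r ger0_norm //.
    by rewrite addr_ge0.
  have m0 : m != 0 by rewrite -normr_eq0 m1 oner_eq0.
  (* The preimage of [m] under the Möbius map $u \mapsto (\bar a u + \bar b)/(a + bu)$. *)
  pose u := (a * m - b^*) / (a^* - b * m).
  have dn : a^* - b * m != 0.
    rewrite subr_eq0; apply: contraTneq ltba => e.
    by rewrite -(norm_conjC a) e normrM m1 mulr1 ltxx.
  have mJ : m * m^* = 1 by rewrite -normCK m1 expr1n.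
  have u1 : `|u| = 1.
    rewrite /u normf_div -(norm_conjC (a^* - b * m)).
    rewrite [(a^* - b * m)^*]rmorphB rmorphM /= conjCK.
    have -> : a * m - b^* = m * (a - b^* * m^*).
      by rewrite mulrBr [b^* * _]mulrC mulrA mJ mul1r mulrC.
    rewrite normrM m1 mul1r divff // normr_eq0.
    by rewrite -rmorphM -{1}(conjCK a) -rmorphB /= conjC_eq0.
  have um : a^* * u + b^* = m * (a + b * u).
    by rewrite /u; field.
  have := circ u u1; rewrite pq um mulrA.
  have -> : p * (a + b * u) + q * m * (a + b * u) = (p + q * m) * (a + b * u).
    by ring.
  by rewrite normrM ger_pMl // normr_gt0 denom_neq0 // u1.
rewrite pq; apply: le_trans (ler_normD _ _) _; rewrite !normrM.
have mz : `|a^* * z + b^*| <= `|a + b * z|.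
  rewrite -(@ler_pXn2r _ 2) ?nnegrE // !normCK -subr_ge0.
  rewrite !rmorphD !rmorphM /= !conjCK.
  have -> : (a + b * z) * (a^* + b^* * z^*) - (a^* * z + b^*) * (a * z^* + b)
     = D * (1 - z * z^*) by rewrite /D; ring.
  by rewrite mulr_ge0 ?(ltW D0) // -normCK subr_ge0 exprn_ile1.
apply: le_trans (_ : (`|p| + `|q|) * `|a + b * z| <= _); last first.
  by rewrite ler_piMl.
by rewrite mulrDl lerD2l ler_wpM2l.
Qed.

End ComplexPlane.

Section LeeYang.
Variables (C : numClosedFieldType) (I : finType).
Implicit Types (f g : {set I} -> C) (S T U : {set I}) (z w : I -> C).

(** With coefficients indexed by subsets, Asano contraction of all variables is the pointwise
    product of coefficient functions. Restricting the variables to [U] allows induction on them. *)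
Definition multiaffine f U z : C :=
  \sum_(S : {set I} | S \subset U) f S * \prod_(i in S) z i.

Definition lee_yang f U :=
  forall z, (forall i, `|z i| < 1) -> multiaffine f U z != 0.

Lemma eq_lee_yang f g U : g =1 f -> lee_yang f U -> lee_yang g U.
Proof.
move=> fg lyf z z1; rewrite /multiaffine; under eq_bigr do rewrite fg.
exact: lyf.
Qed.

Lemma sum_subset_setU1 (V : nmodType) (F : {set I} -> V) i U : i \notin U ->
  \sum_(S : {set I} | S \subset i |: U) F S =
  \sum_(S : {set I} | S \subset U) (F S + F (i |: S)).
Proof.
move=> iU; rewrite big_split /= (bigID (fun S : {set I} => i \in S)) /= addrC.
congr (_ + _).
  by apply: eq_bigl => S; rewrite -subsetD1 setU1K.
rewrite (reindex_onto (fun S => i |: S) (fun S => S :\ i)) /=; last first.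
  by move=> S /andP[_ iS]; rewrite setD1K.
apply: eq_bigl => S; rewrite setU11 andbT subUset sub1set setU11 /=.
have [iS|iS] := boolP (i \in S).
  rewrite andbC; case: eqP => [/setP/(_ i)|_] /=; first by rewrite !inE eqxx iS.
  by apply/esym/negbTE; apply: contra iU => /subsetP/(_ i iS).
rewrite setU1K // eqxx andbT.
by rewrite -[in RHS](setU1K iU) subsetD1 iS andbT.
Qed.

Lemma multiaffine_setU1 f i U z : i \notin U ->
  multiaffine f (i |: U) z =
  multiaffine (fun S => f S + z i * f (i |: S)) U z.
Proof.
move=> iU; rewrite /multiaffine sum_subset_setU1 //.
apply: eq_bigr => S SU; rewrite mulrDl; congr (_ + _).
have iS : i \notin S by apply: contra iU; apply: (subsetP SU).
by rewrite big_setU1 //= mulrCA mulrA.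
Qed.

Lemma multiaffine0 f z : multiaffine f set0 z = f set0.
Proof.
rewrite /multiaffine (big_pred1 set0) ?big_set0 ?mulr1 // => S.
by rewrite subset0.
Qed.

Lemma lee_yang_fix_variable f i U (x : C) : i \notin U -> `|x| < 1 ->
  lee_yang f (i |: U) -> lee_yang (fun S => f S + x * f (i |: S)) U.
Proof.
move=> iU x1 lyf z z1; pose z' j := if j == i then x else z j.
have z'1 j : `|z' j| < 1 by rewrite /z'; case: ifP.
have := lyf z' z'1; rewrite multiaffine_setU1 // {1}/z' eqxx.
congr (_ != 0); apply: eq_bigr => S SU; congr (_ * _).
apply: eq_bigr => j jS; rewrite /z'; case: eqP => // ji.
by rewrite -ji (subsetP SU) in iU.
Qed.

(* Fixing the value of one variable keeps the Lee-Yang property, so the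
   variables can be contracted one at a time. *)
Lemma lee_yang_hadamard f g U :
  lee_yang f U -> lee_yang g U -> lee_yang (fun S => f S * g S) U.
Proof.
have [n] := ubnP #|U|; elim: n => [//|n IHn] in f g U *.
have [->|[i iU]] := set_0Vmem U.
  move=> _ lyf lyg z z1; have := mulf_neq0 (lyf z z1) (lyg z z1).
  by rewrite !multiaffine0.
rewrite -(setD1K iU) cardsU1 setD11 ltnS; move: (setD11 i U).
move: {U iU}(U :\ i) => U /negbT iU cU lyf lyg z z1.
rewrite multiaffine_setU1 //.
have -> : multiaffine (fun S => f S * g S + z i * (f (i |: S) * g (i |: S))) U z
   = multiaffine (fun S => f S * g S) U z
     + multiaffine (fun S => f (i |: S) * g (i |: S)) U z * z i.
  rewrite /multiaffine mulr_suml -big_split /=.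
  by apply: eq_bigr => S _; ring.
(* The mixed coefficients appear when variable [i] is fixed at [x] in [f] and at [y] in [g]; the
   induction hypothesis covers these two slices. *)
apply: (@asano_contraction _ _
    (multiaffine (fun S => f (i |: S) * g S) U z)
    (multiaffine (fun S => f S * g (i |: S)) U z)) => // x y x1 y1.
have := IHn _ _ U cU (lee_yang_fix_variable iU x1 lyf)
  (lee_yang_fix_variable iU y1 lyg) z z1.
congr (_ != 0); rewrite /multiaffine !mulr_suml -!big_split /=.
by apply: eq_bigr => S _; ring.
Qed.

Lemma multiaffine1 z : multiaffine (fun=> 1) setT z = \prod_i (1 + z i).
Proof.
rewrite /multiaffine; under [RHS]eq_bigr do rewrite addrC.
rewrite bigA_distr; apply: eq_big => [S|S _]; first by rewrite subsetT inE.
by rewrite mul1r [LHS]big_mkcond.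
Qed.

Lemma one_plus_neq0 (x : C) : `|x| < 1 -> 1 + x != 0.
Proof.
move=> x1; apply: contraTneq x1 => /eqP.
by rewrite addrC addr_eq0 => /eqP->; rewrite normrN1 ltxx.
Qed.

Lemma lee_yang1 : lee_yang (fun=> 1) setT.
Proof.
move=> z z1; rewrite multiaffine1; apply/prodf_neq0 => i _.
exact: one_plus_neq0.
Qed.

Lemma lee_yang_prod (J : finType) (P : pred J) (w : J -> {set I} -> C) :
  (forall j, P j -> lee_yang (w j) setT) ->
  lee_yang (fun S => \prod_(j | P j) w j S) setT.
Proof.
move=> lyw; elim: (index_enum J) => [|j r IHr].
  by apply: eq_lee_yang lee_yang1 => S; rewrite big_nil.
have [Pj|/negbTE Pj] := boolP (P j); last first.
  by apply: eq_lee_yang IHr => S; rewrite big_cons Pj.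
apply: eq_lee_yang (lee_yang_hadamard (lyw j Pj) IHr) => S.
by rewrite big_cons Pj.
Qed.

Definition cut (e S : {set I}) := (e :&: S != set0) && (e :\: S != set0).

Definition edge_weight (b : C) e S : C := if cut e S then b else 1.

(** A nonempty edge is uncut when it misses [S] or lies in [S], never both. In this form the sum
    over [S] of each term factors over the vertices. *)
Lemma edge_weightE b e S : e != set0 ->
  edge_weight b e S = b + (1 - b) * (e :&: S == set0)%:R + (1 - b) * (e \subset S)%:R.
Proof.
move=> e0; rewrite /edge_weight /cut setD_eq0.
have [eS|_] := eqVneq (e :&: S) set0; have [eS'|_] := boolP (e \subset S) => /=.
- by move: e0; rewrite -eS (setIidPl eS') eqxx.
- by rewrite mulr1 mulr0 addr0 addrC subrK.
- by rewrite mulr1 mulr0 addr0 addrC subrK.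
by rewrite !mulr0 !addr0.
Qed.

Lemma multiaffine_edge b e z : e != set0 ->
  multiaffine (edge_weight b e) setT z =
  (\prod_(i in ~: e) (1 + z i)) *
  (b * (\prod_(i in e) (1 + z i)) + (1 - b) * (1 + \prod_(i in e) z i)).
Proof.
move=> e0; rewrite /multiaffine.
have prodT (S : {set I}) : \prod_(i in S) z i = \prod_i (if i \in S then z i else 1).
  by rewrite big_mkcond.
have sum_disjoint : \sum_(S : {set I} | S \subset setT)
    (e :&: S == set0)%:R * \prod_(i in S) z i = \prod_(i in ~: e) (1 + z i).
  rewrite [RHS]big_mkcond /=.
  (* In the expanded product, the 0 at vertices of [e] kills every [S] that meets [e]; in
     [sum_contains] the 0 kills every [S] that omits a vertex of [e]. *)
  rewrite (eq_bigr (fun i => (if i \in e then 0 else z i) + 1)); last first.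
    by move=> i _; rewrite inE; case: (i \in e); rewrite ?add0r // addrC.
  rewrite bigA_distr; apply: eq_big => [S|S _]; first by rewrite subsetT inE.
  have [eS|/set0Pn[j]] := eqVneq (e :&: S) set0.
    rewrite mul1r prodT; apply: eq_bigr => i _; case: ifP => // iS.
    by case: ifP => // ie; have := in_set0 i; rewrite -eS inE iS ie.
  by rewrite inE => /andP[je jS]; rewrite mul0r (bigD1 j) //= jS je mul0r.
have sum_contains : \sum_(S : {set I} | S \subset setT)
    (e \subset S)%:R * \prod_(i in S) z i
    = \prod_(i in ~: e) (1 + z i) * \prod_(i in e) z i.
  rewrite mulrC [X in X * _]big_mkcond [X in _ * X]big_mkcond -big_split /=.
  rewrite (eq_bigr (fun i => z i + (if i \in e then 0 else 1))); last first.
    move=> i _; rewrite inE; case: (i \in e) => /=.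
      by rewrite mulr1 addr0.
    by rewrite mul1r addrC.
  rewrite bigA_distr; apply: eq_big => [S|S _]; first by rewrite subsetT inE.
  have [eS|/subsetPn[i ie iS]] := boolP (e \subset S).
    rewrite mul1r prodT; apply: eq_bigr => i _; case: ifP => // iS.
    by case: ifP => // ie; rewrite (subsetP eS) in iS.
  by rewrite mul0r (bigD1 i) //= (negbTE iS) ie mul0r.
under [LHS]eq_bigr => S _ do rewrite edge_weightE // !mulrDl -!mulrA.
rewrite !big_split /= -!mulr_sumr sum_disjoint sum_contains.
have -> : \sum_(S : {set I} | S \subset setT) \prod_(i in S) z i
   = \prod_(i in ~: e) (1 + z i) * \prod_(i in e) (1 + z i).
  transitivity (multiaffine (fun=> 1) setT z).
    by apply: eq_bigr => S _; rewrite mul1r.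
  rewrite multiaffine1 (bigID [in e]) /= mulrC; congr (_ * _).
  by apply: eq_bigl => i; rewrite inE.
ring.
Qed.

End LeeYang.

(** * A single hyperedge *)

Section EdgeFactor.
Variable C : numClosedFieldType.
Implicit Types (a b x y z : C) (r s t : seq C).

Definition edgeA b s : C := 1 - b + b * \prod_(x <- s) (1 + x).
Definition edgeB b s : C :=
  (1 - b) * \prod_(x <- s) x + b * \prod_(x <- s) (1 + x).

Definition in_disc x := `|x| < 1.
Definition in_cdisc x := `|x| <= 1.

Lemma affine_neq0_cdisc a b :
  (forall z, `|z| <= 1 -> a + b * z != 0) -> `|b| < `|a|.
Proof.
move=> nz; rewrite real_ltNge ?normr_real //; apply/negP => leab.
have [b0|b0] := eqVneq b 0.
  move: leab; rewrite b0 normr0 normr_le0 => /eqP a0.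
  by have := nz 0; rewrite normr0 ler01 a0 b0 mulr0 addr0 eqxx => /(_ isT).
have := nz (- (a / b)); rewrite normrN normf_div ler_pdivrMr ?normr_gt0 //.
by rewrite mul1r leab mulrN mulrC divfK // subrr eqxx => /(_ isT).
Qed.

(** On the torus $1 + x = x(1 + \bar x)$, so for real $b$ [edgeB] is $\prod x$ times the conjugate
    of [edgeA]. *)
Lemma edgeB_torus b s : b \is Num.real -> all (fun x => `|x| == 1) s ->
  `|edgeB b s| = `|edgeA b s|.
Proof.
move=> br s1.
have [p1 pX] : `|\prod_(x <- s) x| = 1 /\
   \prod_(x <- s) (1 + x) = \prod_(x <- s) x * (\prod_(x <- s) (1 + x))^*.
  elim: s s1 => [_|x s IHs /= /andP[/eqP x1 /IHs[p1 pX]]].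
    by rewrite !big_nil normr1 rmorph1 mulr1.
  rewrite !big_cons normrM x1 p1 mulr1; split=> //.
  rewrite {1}pX rmorphM rmorphD rmorph1.
  have xJ : x * x^* = 1 by rewrite -normCK x1 expr1n.
  have -> : 1 + x = x * (1 + x^*) by rewrite mulrDr mulr1 xJ addrC.
  ring.
have -> : edgeB b s = \prod_(x <- s) x * (edgeA b s)^*.
  rewrite /edgeB {1}pX /edgeA rmorphD rmorphM rmorphB rmorph1 /= (CrealP br).
  ring.
by rewrite normrM p1 mul1r norm_conjC.
Qed.

(* Maximum principle on the polydisc, one variable at a time, starting from
   equality on the torus. *)
Lemma edgeB_le_edgeA_strict b n : b \is Num.real ->
  (forall s, (size s <= n)%N -> all in_cdisc s -> edgeA b s != 0) ->
  forall t s, (size (t ++ s) <= n)%N -> all in_cdisc t ->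
    all (fun x => `|x| == 1) s -> `|edgeB b (t ++ s)| <= `|edgeA b (t ++ s)|.
Proof.
move=> br nz; elim=> [|u t IHt] s.
  by move=> _ _ s1; rewrite /= edgeB_torus.
move=> sz /= /andP[u1 t1] s1.
set X := \prod_(x <- t ++ s) (1 + x); set Y := \prod_(x <- t ++ s) x.
have eA v : edgeA b (v :: t ++ s) = (1 - b + b * X) + (b * X) * v.
  by rewrite /edgeA big_cons -/X; ring.
have eB v : edgeB b (v :: t ++ s) = b * X + ((1 - b) * Y + b * X) * v.
  by rewrite /edgeB !big_cons -/X -/Y; ring.
rewrite eA eB; apply: affine_quotient_max => // [|v v1].
  apply: affine_neq0_cdisc => z z1; rewrite -eA; apply: nz => //=.
  rewrite /in_cdisc z1 all_cat t1 /=; apply: sub_all s1 => x /eqP x1.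
  by rewrite /in_cdisc x1.
(* Once [v] is on the circle it joins the torus list, where the induction hypothesis applies. *)
have := IHt (v :: s); rewrite -eA -eB /edgeA /edgeB.
rewrite !big_cons !big_cat !big_cons /= !(mulrCA _ v) !(mulrCA _ (1 + v)).
by rewrite v1 eqxx size_cat /= addnS -size_cat; apply.
Qed.

(** Nonvanishing on the closed polydisc is available only after shrinking $b$ to $(1 - d)b$; the
    inequality survives the limit $d \to 0$. *)
Lemma edgeB_le_edgeA b n : b \is Num.real ->
  (forall d s, 0 < d <= 1 -> (size s <= n)%N -> all in_cdisc s ->
     edgeA ((1 - d) * b) s != 0) ->
  forall s, (size s <= n)%N -> all in_cdisc s -> `|edgeB b s| <= `|edgeA b s|.
Proof.
move=> br nz s sn s1.
set X := \prod_(x <- s) (1 + x); set Y := \prod_(x <- s) x.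
(* Shrinking $b$ changes [edgeB] and [edgeA] by amounts whose moduli add up to $dM$; the choice of
   [d] below keeps this at most [e]. *)
pose M := `|b * (X - Y)| + `|b * (X - 1)|.
have M0 : 0 <= M by rewrite addr_ge0.
apply/ler_addgt0Pr => e e0.
have eM : 0 < e + M by rewrite ltr_wpDr.
pose d := e / (e + M).
have d01 : 0 < d <= 1.
  by rewrite divr_gt0 //= ler_pdivrMr // mul1r lerDl.
have dr : d \is Num.real by case/andP: d01 => /gtr0_real.
have dM : d * M <= e.
  by rewrite /d mulrAC ler_pdivrMr // ler_pM2l // lerDr ltW.
have := @edgeB_le_edgeA_strict ((1 - d) * b) n _ _ s [::].
rewrite cats0 => /(_ _ _ sn s1 isT) le_d.
have {le_d} le_d : `|edgeB ((1 - d) * b) s| <= `|edgeA ((1 - d) * b) s|.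
  apply: le_d; first by rewrite rpredM // rpredB // real1.
  by move=> r; apply: nz.
have -> : edgeB b s = edgeB ((1 - d) * b) s + d * (b * (X - Y)).
  by rewrite /edgeB -/X -/Y; ring.
have dd : `|d| = d by rewrite ger0_norm // ltW //; case/andP: d01.
apply: le_trans (ler_normD _ _) _; rewrite normrM dd.
have : `|edgeA ((1 - d) * b) s| <= `|edgeA b s| + d * `|b * (X - 1)|.
  have -> : edgeA ((1 - d) * b) s = edgeA b s - d * (b * (X - 1)).
    by rewrite /edgeA -/X; ring.
  by apply: le_trans (ler_normB _ _) _; rewrite normrM dd.
move=> /(le_trans le_d) le1.
apply: le_trans (lerD le1 (lexx _)) _.
by rewrite -addrA lerD2l -mulrDr addrC (le_trans _ dM) // ler_pM2l //; case/andP: d01.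
Qed.

Lemma dominated_affine_neq0 a b z :
  a != 0 -> `|b| <= `|a| -> `|z| < 1 -> a + b * z != 0.
Proof.
move=> a0 leba z1; rewrite addr_eq0.
apply: contraTneq (leba) => ea; rewrite -real_ltNge ?normr_real //.
rewrite ea normrN normrM; have b0 : b != 0.
  by apply: contraNneq a0 => b0; rewrite ea b0 mul0r oppr0.
by rewrite gtr_pMr // normr_gt0.
Qed.

End EdgeFactor.

Arguments in_disc {C} x.
Arguments in_cdisc {C} x.

Local Open Scope complex_scope.

(** * Zero-free regions of [edgeA] *)

Section Factor.
Implicit Types (x z : R[i]) (s : seq R[i]) (b y : R) (K : nat).

(** Here [K] plays the part of $k - 1$. The value bounds the modulus of a negative product of at
    most [K] points of the disc $|x - 1| \le 1$. *)
Definition neg_bound K : R := (2 * cos (PI / INR K)) ^+ K.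

Lemma neg_bound_ge0 K : (2 <= K)%N -> 0 <= neg_bound K.
Proof.
move=> K2; by rewrite exprn_ge0 // mulr_ge0 //; apply/RleP/cos_PI_div_ge0/ssrnat.leP.
Qed.

Lemma re_im_in_cdisc x : in_cdisc x ->
  complex.Re (1 + x) * complex.Re (1 + x) + complex.Im (1 + x) * complex.Im (1 + x)
    <= 2 * complex.Re (1 + x) :> R.
Proof.
case: x => a c; rewrite /in_cdisc => x1.
have : `|a +i* c| ^+ 2 <= 1 by rewrite exprn_ile1.
by rewrite -add_Re2_Im2 -[1]/(1%:C) lecR /= add0r => h; nra.
Qed.

Lemma prod_in_sector (t : R) s : Rlt 0 t /\ Rlt t (PI / 2) ->
  all in_cdisc s -> \prod_(x <- s) (1 + x) != 0 ->
  in_sector t (size s) (complex.Re (\prod_(x <- s) (1 + x)))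
    (complex.Im (\prod_(x <- s) (1 + x))).
Proof.
move=> ht; elim: s => [|x s IHs] /=.
  by rewrite big_nil => _ _; apply: in_sector1.
rewrite big_cons mulf_eq0 negb_or => /andP[x1 s1] /andP[x0 p0].
have := IHs s1 p0; have := re_im_in_cdisc x1.
move: x0; case: (1 + x) => a c; case: (\prod_(_ <- _) _) => e f x0 /= disc sec.
(* The disc meets the closed left half-plane only at 0, and this factor is nonzero. *)
have a0 : 0 < a.
  rewrite lt_neqAle; apply/andP; split; last by nra.
  apply: contra x0 => /eqP ea; rewrite eq_complex /= -ea eqxx /=.
  by rewrite -sqrf_eq0; apply/eqP; rewrite -ea in disc; nra.
have := @in_sector_mul t (size s) a c e f ht _ _ sec.
rewrite !RealsE [c * e]mulrC; apply; first by apply/RleP.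
by apply/RltP.
Qed.

(** The sector argument needs $\pi / K$ acute, so [K = 2] is separate: the bound is then 0, and a
    negative product is shown to be impossible. *)
Lemma prod_negative_le K s y : (2 <= K)%N -> (size s <= K)%N ->
  all in_cdisc s -> \prod_(x <- s) (1 + x) = (- y)%:C -> 0 < y ->
  y <= neg_bound K.
Proof.
rewrite leq_eqVlt => /predU1P[<-|K3] sK s1 e y0; last first.
  apply/RleP; rewrite /neg_bound -RpowE; apply: (@in_sector_negative K (size s)).
  - exact/ssrnat.leP.
  - exact/ssrnat.leP.
  - have := @prod_in_sector (PI / INR K) s; rewrite e; apply=> //.
      exact/PI_div_acute/ssrnat.leP.
    by rewrite eq_complex /= oppr_eq0 (gt_eqF y0).
  - exact/RltP.
exfalso; case: s sK s1 e => [|x [|x' [|//]]] _ /=.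
- by rewrite big_nil => _ [] e; lra.
- rewrite big_seq1 andbT => /re_im_in_cdisc; case: (1 + x) => a c /= + [ea _].
  by rewrite ea; nra.
rewrite !big_cons big_nil mulr1 => /and3P[/re_im_in_cdisc + /re_im_in_cdisc + _].
case: (1 + x) => a c; case: (1 + x') => a' c' /= h h' [e1 e2].
have a0 : 0 <= a by nra.
have a'0 : 0 <= a' by nra.
(* Real part of the product equation multiplied by the conjugate of [1 + x]. *)
have : a ^+ 2 * a' + c ^+ 2 * a' = - (y * a).
  have -> : y = c * c' - a * a' by lra.
  have -> : c ^+ 2 * a' = - (a * c' * c)
    by rewrite (_ : a * c' = - (c * a')); [ring | lra].
  ring.
have [a_gt0|] := ltP 0 a; first by nra.
move=> a_le0; have aE : a = 0 by lra.
have cE : c = 0 by apply/eqP; rewrite -sqrf_eq0; apply/eqP; rewrite aE in h; nra.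
by move: e1; rewrite aE cE; nra.
Qed.

Lemma edgeA_neq0_cdisc b K s : (2 <= K)%N -> (size s <= K)%N ->
  all in_cdisc s -> 0 <= neg_bound K ->
  b * (neg_bound K + 1) < 1 -> - b * (2 ^+ K - 1) < 1 -> edgeA b%:C s != 0.
Proof.
move=> K2 sK s1 M0 hi lo; rewrite /edgeA; set X := \prod_(_ <- _) _.
apply/eqP => e; have [b0|b0|b0] := ltgtP b 0.
- have Xle : `|X| <= (2 ^+ K)%:C.
    rewrite /X normr_prod rmorphXn /= rmorph_nat.
    apply: le_trans (_ : 2 ^+ size s <= _); last by rewrite ler_weXn2l ?ler1n.
    elim: (s) s1 => [|x r IHr] /=; first by rewrite big_nil.
    move=> /andP[x1 r1]; rewrite big_cons exprS ler_pM ?prodr_ge0 ?IHr //.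
    by apply: le_trans (ler_normD _ _) _; rewrite normr1 lerD2l.
  have : (1 - b)%:C = (- b)%:C * X.
    rewrite rmorphB rmorph1 rmorphN mulNr; apply/eqP.
    by rewrite -subr_eq0 opprK e.
  have b1 : 0 <= (1 - b)%:C by rewrite ler0c; lra.
  have nb : 0 <= (- b)%:C by rewrite ler0c; lra.
  move/(congr1 Num.norm); rewrite normrM (ger0_norm b1) (ger0_norm nb) => eX.
  have : (1 - b)%:C <= (- b)%:C * (2 ^+ K)%:C by rewrite eX ler_wpM2l.
  by rewrite -rmorphM lecR; lra.
- have [b1|b1] := leP 1 b; first by nra.
  have y0 : 0 < (1 - b) / b by rewrite divr_gt0 // subr_gt0.
  have bC : b%:C != 0 by rewrite (inj_eq (@complexI _) b 0) gt_eqF.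
  have := @prod_negative_le K s _ K2 sK s1 _ y0; rewrite -/X.
  have -> : X = (- ((1 - b) / b))%:C.
    rewrite rmorphN rmorphM fmorphV rmorphB rmorph1; apply: (mulfI bC).
    rewrite mulrN mulrCA divff // mulr1; apply/eqP.
    by rewrite eq_sym -subr_eq0 -opprD oppr_eq0 e.
  move=> /(_ erefl); rewrite ler_pdivrMr //; lra.
- by move: e; rewrite b0 subr0 mul0r addr0 => /eqP; rewrite oner_eq0.
Qed.

(* Pulling one factor away from 0 keeps it in the disc, which makes the
   inequalities of the closed polydisc strict. *)
Lemma edgeA_neq0_disc b K s : (2 <= K)%N -> (size s <= K)%N ->
  all in_disc s -> 0 <= neg_bound K ->
  b * (neg_bound K + 1) <= 1 -> - b * (2 ^+ K - 1) <= 1 -> edgeA b%:C s != 0.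
Proof.
move=> K2 sK s1 M0 hi lo.
have [b1|b1] := eqVneq b 1.
  rewrite /edgeA b1 subrr add0r mul1r prodf_seq_neq0.
  apply: sub_all s1 => x x1 /=; exact: one_plus_neq0.
have {}b1 : 0 < 1 - b.
  rewrite subr_gt0 lt_neqAle b1 /=; have [b0|b0] := leP b 0; first by lra.
  by nra.
case: s sK s1 => [|x s] /= sK.
  by rewrite /edgeA big_nil mulr1 subrK oner_eq0.
move=> /andP[x1 s1]; set X := \prod_(y <- s) (1 + y).
have [k xk] : exists k : R, `|x| = k%:C by apply/complex_realP; rewrite normr_real.
have k1 : k < 1 by move: x1; rewrite /in_disc xk -ltcR.
have [eps e0 epsk] : exists2 eps : R, 0 < eps & k + eps * 2 <= 1.
  by exists ((1 - k) / 2); lra.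
(* So $1 + x' = (1 + \varepsilon)(1 + x)$, and $|x'| \le |x| + 2\varepsilon \le 1$. *)
pose x' := x + eps%:C * (1 + x).
have x'1 : in_cdisc x'.
  rewrite /in_cdisc; apply: le_trans (ler_normD _ _) _.
  have e0C : 0 <= eps%:C by rewrite ler0c ltW.
  rewrite normrM (ger0_norm e0C).
  apply: le_trans (_ : k%:C + eps%:C * 2 <= _).
    rewrite xk lerD2l ler_wpM2l //.
    by apply: le_trans (ler_normD _ _) _; rewrite normr1 lerD2l ltW.
  have -> : k%:C + eps%:C * 2 = (k + eps * 2)%:C.
    by rewrite rmorphD rmorphM /= rmorph_nat.
  by rewrite (lecR _ 1).
(* Chosen so that [edgeA] at $b'$ and $x'$ is $(1 + \varepsilon)/(1 + \varepsilon(1 - b))$ times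
   [edgeA] at $b$ and $x$. The denominator exceeds 1, which makes both bounds strict. *)
pose b' := b / (1 + eps * (1 - b)).
have den : 0 < 1 + eps * (1 - b) by rewrite addr_gt0 // mulr_gt0.
have := @edgeA_neq0_cdisc b' K (x' :: s) K2 sK _ M0.
have -> /= : all in_cdisc (x' :: s).
  by rewrite /= x'1; apply: sub_all s1 => y /ltW.
have ed : 0 < eps * (1 - b) by rewrite mulr_gt0.
have hi' : b' * (neg_bound K + 1) < 1.
  by rewrite /b' mulrAC ltr_pdivrMr // mul1r; lra.
have lo' : - b' * (2 ^+ K - 1) < 1.
  by rewrite /b' -mulNr mulrAC ltr_pdivrMr // mul1r; lra.
move=> /(_ isT hi' lo'); apply: contra => /eqP; rewrite /edgeA !big_cons -/X => e.
have denC : 1 + eps%:C * (1 - b%:C) != 0.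
  by have := lt0r_neq0 den; rewrite -(inj_eq (@complexI _)) rmorphD rmorphM
    rmorphB rmorph1.
rewrite /x' /b' rmorphM fmorphV rmorphD rmorphM rmorphB rmorph1.
apply/eqP; rewrite -[RHS](mul0r ((1 + eps%:C) / (1 + eps%:C * (1 - b%:C)))) -e.
by field.
Qed.

End Factor.

(** * Zeros on the unit circle *)

Section Ising.
Implicit Types (b : R) (K n : nat).

Lemma lee_yang_edge (I : finType) (e : {set I}) b K : (2 <= K)%N ->
  (2 <= #|e| <= K.+1)%N -> b * (neg_bound K + 1) <= 1 ->
  - b * (2 ^+ K - 1) <= 1 -> lee_yang (edge_weight b%:C e) setT.
Proof.
move=> K2 /andP[e2 eK] hi lo z z1; have M0 := neg_bound_ge0 K2.
have e0 : e != set0 by rewrite -card_gt0; apply: leq_trans e2.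
rewrite multiaffine_edge // mulf_neq0 //.
  by apply/prodf_neq0 => i _; apply: one_plus_neq0.
have [j je] := set0Pn _ e0.
pose s := [seq z i | i <- enum (e :\ j)].
have sK : (size s <= K)%N.
  by rewrite size_map -cardE; move: eK; rewrite (cardsD1 j) je.
have s1 : all in_disc s by apply/allP => _ /mapP[i _ ->]; apply: z1.
have -> : b%:C * \prod_(i in e) (1 + z i) + (1 - b%:C) * (1 + \prod_(i in e) z i)
    = edgeA b%:C s + edgeB b%:C s * z j.
  rewrite /edgeA /edgeB /s !big_map !big_enum /= !(big_setD1 j je) /=.
  by ring.
apply: dominated_affine_neq0 => //; first exact: edgeA_neq0_disc hi lo.
apply: (@edgeB_le_edgeA _ b%:C K) => // [|d r /andP[d0 d1] rK r1|].
- by apply/complex_realP; exists b.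
- have [d' ed] : exists d' : R, d = d'%:C.
    by apply/complex_realP; rewrite gtr0_real.
  move: d0 d1; rewrite ed (ltcR 0) (lecR _ 1) => d0 d1.
  have -> : (1 - d'%:C) * b%:C = ((1 - d') * b)%:C.
    by rewrite rmorphM rmorphB rmorph1.
  apply: edgeA_neq0_cdisc rK r1 M0 _ _ => //.
    by rewrite -mulrA; nra.
  by rewrite -mulrN -mulrA; nra.
- by apply: sub_all s1 => x /ltW.
Qed.

Definition toC (z : Cplx) : R[i] := Defs.Re z +i* Defs.Im z.

Lemma toCK z : toC z = 0 -> z = C0.
Proof. by case: z => a c [-> ->]. Qed.

Lemma toC_pow z n : toC (Cpow z n) = toC z ^+ n.
Proof. by elim: n => [//|n IHn]; rewrite exprS -IHn. Qed.

Lemma toC_scale (a : R) z : toC (Cscale a z) = a%:C * toC z.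
Proof.
by apply/eqP; rewrite eq_complex /= !mul0r subr0 addr0 !RealsE !eqxx.
Qed.

Lemma Cnorm2E z : (Cnorm2 z)%:C = `|toC z| ^+ 2.
Proof. by rewrite -add_Re2_Im2. Qed.

Lemma Cnorm2_eq1 z : Cnorm2 z = 1 <-> `|toC z| = 1.
Proof.
split=> [z1|z1]; last by apply: (@complexI R); rewrite Cnorm2E z1 expr1n.
by apply/eqP; rewrite -(@eqrXn2 _ 2) // -Cnorm2E z1 expr1n.
Qed.

(** All variables are set to $\lambda$, and the coefficient is a product over edges, so that
    [lee_yang_prod] reduces the problem to one edge. *)
Lemma toC_Zising n (E : {set {set 'I_n}}) b lam :
  toC (Zising E b lam) =
  multiaffine (fun S => \prod_(e in E) edge_weight b%:C e S) setT
    (fun=> toC lam).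
Proof.
transitivity (\sum_(S : {set 'I_n})
    (b ^+ #|cut_edges E S|)%:C * toC lam ^+ #|S|).
  transitivity (\sum_(S <- enum [set: {set 'I_n}])
    (b ^+ #|cut_edges E S|)%:C * toC lam ^+ #|S|).
    rewrite /Zising; elim: (enum _) => [|S s IHs] /=; first by rewrite big_nil.
    by rewrite big_cons -IHs -toC_pow -RpowE -toC_scale.
  by rewrite big_enum; apply: eq_bigl => S; rewrite inE.
apply: eq_big => [S|S _]; first by rewrite subsetT.
rewrite prodr_const; congr (_ * _).
rewrite rmorphXn /= -prodr_const.
rewrite [LHS](eq_bigl (fun e => (e \in E) && cut e S)); last first.
  by move=> e; rewrite inE.
by rewrite big_mkcondr.
Qed.

Lemma cutC (I : finType) (e S : {set I}) : cut e (~: S) = cut e S.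
Proof. by rewrite /cut !setDE setCK andbC. Qed.

(** Complementation exchanges the monomials $x^{|S|}$ and $x^{n - |S|}$. *)
Lemma multiaffine_inv (C : numClosedFieldType) n (f : {set 'I_n} -> C) (x : C) :
  x != 0 -> (forall S, f (~: S) = f S) ->
  multiaffine f setT (fun=> x^-1) * x ^+ n = multiaffine f setT (fun=> x).
Proof.
move=> x0 fC; rewrite /multiaffine mulr_suml.
rewrite (reindex_inj (inv_inj (@setCK _))) /=.
apply: eq_big => [S|S _]; first by rewrite !subsetT.
rewrite fC !prodr_const -mulrA; congr (_ * _).
have en : (#|S| + #|~: S|)%N = n by rewrite cardsC card_ord.
by rewrite -[x ^+ n](congr1 (GRing.exp x) en) exprD exprVn mulrCA
  mulVf ?mulr1 // expf_neq0.
Qed.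

Lemma Zising_zero_on_circle K n (E : {set {set 'I_n}}) b lam : (2 <= K)%N ->
  (forall e, e \in E -> (2 <= #|e| <= K.+1)%N) ->
  b * (neg_bound K + 1) <= 1 -> - b * (2 ^+ K - 1) <= 1 ->
  Zising E b lam = C0 -> Cnorm2 lam = 1.
Proof.
move=> K2 cardE hi lo Z0; apply/Cnorm2_eq1.
have := toC_Zising E b lam; rewrite Z0 => /esym.
set f := (fun S => \prod_(e in E) _); move: (toC lam) => x M0.
have lyf : lee_yang f setT.
  by apply: lee_yang_prod => e eE; apply: lee_yang_edge (cardE e eE) hi lo.
have out (y : R[i]) : `|y| < 1 -> multiaffine f setT (fun=> y) != 0.
  by move=> y1; apply: lyf.
apply/eqP; rewrite eq_le !real_leNgt ?normr_real ?real1 //; apply/andP; split.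
  apply/negP => x1; have x0 : x != 0 by rewrite -normr_gt0 (lt_trans ltr01).
  have := out x^-1; rewrite normfV invf_lt1 ?normr_gt0 // => /(_ x1).
  rewrite -(inj_eq (mulIf (expf_neq0 n x0))) mul0r multiaffine_inv // ?M0 ?eqxx //.
  by move=> S; apply: eq_bigr => e _; rewrite /edge_weight cutC.
by apply/negP => /out; rewrite M0 eqxx.
Qed.

Lemma toC_Zising_one_edge K b lam :
  toC (Zising [set [set: 'I_K.+1]] b lam) =
  b%:C * (1 + toC lam) ^+ K.+1 + (1 - b%:C) * (1 + toC lam ^+ K.+1).
Proof.
rewrite toC_Zising; transitivity (multiaffine
    (edge_weight b%:C [set: 'I_K.+1]) setT (fun=> toC lam)).
  by apply: eq_bigr => S _; rewrite big_set1.
rewrite multiaffine_edge; last by rewrite -card_gt0 cardsT card_ord.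
by rewrite setCT big_set0 mul1r !prodr_const cardsT card_ord.
Qed.

End Ising.

(** * Zeros off the unit circle *)

Section Converse.
Implicit Types (b : R) (K n : nat).

(** A new factor $X - r$ turns $g'^2 - gg''$ into $g^2 + (t - r)^2(g'^2 - gg'')$. The values are
    carried along as real because squares in [F] are nonnegative only for real elements. *)
Lemma laguerre_inequality (F : numFieldType) (rs : seq F) (t : F) :
  t \is Num.real -> all (mem Num.real) rs ->
  let g := \prod_(r <- rs) ('X - r%:P) in
  [/\ g.[t] \is Num.real, g^`().[t] \is Num.real, g^`()^`().[t] \is Num.real
    & 0 <= g^`().[t] ^+ 2 - g.[t] * g^`()^`().[t]].
Proof.
move=> tr; elim: rs => [|r rs IHrs] /=.
  by rewrite big_nil derivC deriv0 !hornerE expr0n /= subrr real0 real1.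
move=> /andP[rr /IHrs]; rewrite big_cons; set g := \prod_(_ <- _) _.
case=> g0 g1 g2 lag.
have er : t - r \is Num.real by rewrite rpredB.
have d1 : (('X - r%:P) * g)^`() = g + ('X - r%:P) * g^`().
  by rewrite derivM derivXsubC mul1r.
have d2 : (('X - r%:P) * g)^`()^`() = g^`() *+ 2 + ('X - r%:P) * g^`()^`().
  by rewrite d1 derivD derivM derivXsubC mul1r addrA mulr2n.
rewrite d2 d1 !hornerE; split; do ?by rewrite ?(rpredD, rpredM, rpredN).
rewrite [X in 0 <= X](_ : _ = g.[t] ^+ 2
    + (t - r) ^+ 2 * (g^`().[t] ^+ 2 - g.[t] * g^`()^`().[t])); last by ring.
apply: addr_ge0; first exact: real_exprn_even_ge0.
by apply: mulr_ge0 => //; apply: real_exprn_even_ge0.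
Qed.

(** Were all roots real, Laguerre's inequality at the critical point [t] would give $q(t)q''(t) \le
    0$. *)
Lemma nonreal_root (C : numClosedFieldType) (q : {poly C}) (t : C) :
  t \is Num.real -> 0 < q.[t] -> q^`().[t] = 0 -> 0 < q^`()^`().[t] ->
  exists2 r, root q r & r \isn't Num.real.
Proof.
move=> tr q0 q1 q2; have [rs eq] := closed_field_poly_normal q.
set a := lead_coef q in eq; set g := \prod_(_ <- _) _ in eq.
have [rsr|/allPn[r rs_r r_nr]] := boolP (all (mem Num.real) rs); last first.
  exists r => //; rewrite eq rootZ ?root_prod_XsubC // lead_coef_eq0.
  by apply: contraTneq q0 => ->; rewrite horner0 ltxx.
have /= [] := laguerre_inequality tr rsr; rewrite -/g => g0 g1 g2 lag.
move: q0 q1 q2; rewrite eq !derivZ !hornerZ => q0 q1 q2.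
have a0 : a != 0 by apply: contraTneq q0 => ->; rewrite mul0r ltxx.
have gt0 : g.[t] != 0 by apply: contraTneq q0 => ->; rewrite mulr0 ltxx.
have ar : a \is Num.real.
  by rewrite -[a](mulfK gt0) rpredM ?rpredV // gtr0_real.
have := mulr_gt0 q0 q2; rewrite mulrACA.
move: lag; have /eqP -> : g^`().[t] == 0.
  by move/eqP: q1; rewrite mulf_eq0 (negbTE a0).
rewrite expr0n sub0r oppr_ge0 => lag.
have a2 : 0 <= a * a by rewrite -expr2 real_exprn_even_ge0.
by move=> /(lt_le_trans)/(_ (mulr_ge0_le0 a2 lag)); rewrite ltxx.
Qed.

Lemma deMoivre (t : R) n :
  (cos t +i* sin t) ^+ n = cos (INR n * t) +i* sin (INR n * t).
Proof.
elim: n => [|n IHn]; first by rewrite /= Rmult_0_l cos_0 sin_0.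
rewrite exprS IHn S_INR; apply/eqP; rewrite eq_complex /=.
have -> : Rmult (Rplus (INR n) 1) t = Rplus t (Rmult (INR n) t).
  by rewrite !RealsE; ring.
by rewrite cos_plus sin_plus !RealsE addrC eqxx addrC eqxx.
Qed.

(* The Cayley image in the variable [t], where [z = (1 - i t) / (1 + i t)], of
   the partition function of a single edge of size [n]. *)
Definition cayley_poly (b:R) n : {poly R[i]} :=
  (1 - b%:C)%:P * ((1 + 'i%:P * 'X) ^+ n + (1 - 'i%:P * 'X) ^+ n)
  + (b%:C * 2 ^+ n)%:P.

Lemma horner_cayley b n t : (cayley_poly b n).[t] =
  (1 - b%:C) * ((1 + 'i * t) ^+ n + (1 - 'i * t) ^+ n) + b%:C * 2 ^+ n.
Proof. by rewrite /cayley_poly !hornerE. Qed.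

Lemma deriv_cayley b n : (cayley_poly b n.+1)^`() =
  ((1 - b%:C) * 'i * n.+1%:R)%:P *
     ((1 + 'i%:P * 'X) ^+ n - (1 - 'i%:P * 'X) ^+ n).
Proof.
rewrite /cayley_poly !(derivE, deriv_exp) /= !polyCM polyC_natr.
by ring.
Qed.

Lemma deriv2_cayley b n : (cayley_poly b n.+2)^`()^`() =
  (- ((1 - b%:C) * n.+2%:R * n.+1%:R))%:P *
     ((1 + 'i%:P * 'X) ^+ n + (1 - 'i%:P * 'X) ^+ n).
Proof.
have i2 : 'i%:P * 'i%:P = - 1 :> {poly R[i]}.
  by rewrite -polyCM -expr2 sqr_i polyCN.
rewrite deriv_cayley !(derivE, deriv_exp) /= polyCN !polyCM !polyC_natr.
by ring: i2.
Qed.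

(* At [t = tan (pi / K)], where [1 + i t] is a multiple of [e^(i pi / K)], the
   polynomial has a positive minimum, which is impossible when all its roots
   are real. *)
Lemma cayley_nonreal_root b K : (3 <= K)%N -> b < 1 ->
  1 < b * (neg_bound K + 1) ->
  exists2 r, root (cayley_poly b K.+1) r & r \isn't Num.real.
Proof.
move=> K3 b1 hi; have [m Km] : exists m, K = m.+1.
  by case: K K3 {hi} => [//|m] _; exists m.
have [t0 t1] := @PI_div_acute K (elimT ssrnat.leP K3).
pose t := Rdiv PI (INR K); rewrite -/t in t0 t1.
have c0 : 0 < cos t.
  by apply/RltP/cos_gt_0 => //; apply: Rlt_trans t0; apply: _PI2_RLT_0.
(* $w = e^{i\pi/K}$ satisfies $w^K = -1$, and $w'$ is both its conjugate and its inverse. *)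
pose w : R[i] := cos t +i* sin t; pose w' : R[i] := cos t -i* sin t.
have ww' : w * w' = 1.
  apply/eqP; rewrite eq_complex /=; apply/andP; split; apply/eqP.
    by have := sin2_cos2 t; rewrite /Rsqr !RealsE => <-; ring.
  by ring.
have Kt : Rmult (INR K) t = PI.
  rewrite /t Rmult_comm /Rdiv Rmult_assoc Rinv_l ?Rmult_1_r //.
  by apply: not_0_INR; rewrite Km.
have wK : w ^+ K = -1.
  rewrite deMoivre Kt cos_PI sin_PI; apply/eqP.
  by rewrite eq_complex /= oppr0 !eqxx.
have w'K : w' ^+ K = -1.
  by rewrite -[LHS]mul1r -[X in X * _]opprK -wK mulNr -exprMn ww' expr1n.
have wm : w ^+ m = - w'.
  by rewrite -[LHS]mulr1 -ww' mulrA -exprSr -Km wK mulN1r.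
have w'm : w' ^+ m = - w.
  by rewrite -[LHS]mulr1 -ww' mulrCA -exprSr -Km w'K mulrN1.
have ww : w + w' = (2 * cos t)%:C.
  apply/eqP; rewrite eq_complex /= subrr eqxx andbT; apply/eqP; ring.
pose x : R[i] := (sin t / cos t)%:C.
have cC : (cos t)%:C != 0 by rewrite (inj_eq (@complexI _) (cos t) 0) gt_eqF.
have ex : 1 + 'i * x = w / (cos t)%:C.
  apply: (mulIf cC); rewrite divfK // /x.
  by apply/eqP; rewrite eq_complex /=; apply/andP; split; apply/eqP; field;
    rewrite gt_eqF.
have ex' : 1 - 'i * x = w' / (cos t)%:C.
  apply: (mulIf cC); rewrite divfK // /x.
  by apply/eqP; rewrite eq_complex /=; apply/andP; split; apply/eqP; field;
    rewrite gt_eqF.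
apply: (@nonreal_root _ _ x).
- by apply/complex_realP; eexists.
(* After clearing powers of $\cos t$, positivity of the value is exactly the hypothesis [hi]. *)
- rewrite horner_cayley ex ex' !expr_div_n -mulrDl.
  rewrite [w ^+ K.+1]exprSr [w' ^+ K.+1]exprSr wK w'K !mulN1r -opprD ww.
  rewrite [X in 0 < X](_ : _ =
      ((1 - b) * (- (2 * cos t) / cos t ^+ K.+1) + b * 2 ^+ K.+1)%:C); last first.
    rewrite rmorphD !rmorphM rmorphB rmorphN fmorphV !rmorphXn /= rmorph1.
    by rewrite rmorphM /= !rmorph_nat.
  have -> : - (2 * cos t) / cos t ^+ K.+1 = - 2 / cos t ^+ K.
    by rewrite exprSr; field; rewrite expf_neq0 ?gt_eqF.
  rewrite (ltcR 0) mulrA -ltrBlDl sub0r -mulNr ltr_pdivrMr ?exprn_gt0 //.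
  rewrite /neg_bound exprMn -/t in hi; rewrite exprS; lra.
- rewrite deriv_cayley hornerM; apply/eqP; rewrite mulf_eq0; apply/orP; right.
  by rewrite !hornerE ex ex' !expr_div_n wK w'K subrr.
(* Here $m = K - 1$ and $w^m + w'^m = -(w + w') = -2\cos t$, which cancels the minus sign of the
   second derivative. *)
- rewrite Km deriv2_cayley hornerM hornerC !hornerE ex ex' !expr_div_n wm w'm.
  rewrite -mulrDl -opprD [w' + w]addrC ww.
  have b0 : 0 < 1 - b%:C by rewrite subr_gt0 (ltcR _ 1).
  have c0C : 0 < (cos t)%:C by rewrite (ltcR 0).
  have c2C : 0 < (2 * cos t)%:C by rewrite (ltcR 0) mulr_gt0.
  rewrite [- _%:C / _]mulNr mulrNN; apply: mulr_gt0.
    by rewrite !mulr_gt0 // ltr0Sn.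
  by rewrite divr_gt0 // exprn_gt0.
Qed.

Lemma toC_mkC (x : R[i]) : toC (mkC (complex.Re x) (complex.Im x)) = x.
Proof. by case: x. Qed.

Lemma exists_off_circle_mid b K : (3 <= K)%N -> b < 1 ->
  1 < b * (neg_bound K + 1) ->
  exists lam, Zising [set [set: 'I_K.+1]] b lam = C0 /\ Cnorm2 lam <> 1.
Proof.
move=> K3 b1 hi; have [r /rootP] := cayley_nonreal_root K3 b1 hi.
rewrite horner_cayley => r0 r_nr.
(* Otherwise the value at [r] would be $(1 - b)2^{K+1} + b2^{K+1} = 2^{K+1}$. *)
have den : 1 + 'i * r != 0.
  apply: contraTneq isT => e; move: r0.
  have -> : 1 - 'i * r = 2 by rewrite -[LHS]addr0 -e; ring.
  rewrite e expr0n add0r -mulrDl subrK mul1r => /eqP.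
  by rewrite expf_eq0 /= pnatr_eq0.
pose x := (1 - 'i * r) / (1 + 'i * r).
exists (mkC (complex.Re x) (complex.Im x)); split.
  apply: toCK; rewrite toC_Zising_one_edge toC_mkC.
  apply: (mulIf (expf_neq0 K.+1 den)); rewrite mul0r -[RHS]r0.
  have -> : 1 + x = 2 / (1 + 'i * r) by rewrite /x; field.
  rewrite /x !expr_div_n; field.
  by rewrite expf_neq0.
move/Cnorm2_eq1; rewrite toC_mkC normf_div => x1.
move/negP: r_nr; apply.
(* The two sides differ by $4\,\mathrm{Im}\,r$, so equality makes [r] real. *)
have : `|1 - 'i * r| ^+ 2 = `|1 + 'i * r| ^+ 2.
  by congr (_ ^+ 2); rewrite -[LHS](divfK (_ : `|1 + 'i * r| != 0)) ?x1 ?mul1r ?normr_eq0.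
case: (r) => p q; rewrite -!add_Re2_Im2 => /complexI /= e.
by rewrite complex_real; apply/eqP; lra.
Qed.

Lemma exists_off_circle_low b K : (1 <= K)%N -> 1 < - b * (2 ^+ K - 1) ->
  exists lam, Zising [set [set: 'I_K.+1]] b lam = C0 /\ Cnorm2 lam <> 1.
Proof.
move=> K1 lo.
(* The sign suits [poly_ivt]: the value is $-1$ at 0 and $-2(1 + b(2^K - 1)) > 0$ at 1. *)
pose p : {poly R} :=
  - (b%:P * (1 + 'X) ^+ K.+1 + (1 - b)%:P * (1 + 'X ^+ K.+1)).
have pE x : p.[x] = - (b * (1 + x) ^+ K.+1 + (1 - b) * (1 + x ^+ K.+1)).
  by rewrite /p !hornerE.
have p0 : p.[0] <= 0.
  by rewrite pE addr0 expr1n expr0n /=; lra.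
have p1 : 0 < p.[1].
  by rewrite pE expr1n exprS -[1 + 1]/2; lra.
have [x /andP[x0 x1] /rootP] := poly_ivt ler01 (introT andP (conj p0 (ltW p1))).
rewrite pE => /eqP; rewrite oppr_eq0 => /eqP px.
exists (mkC x 0); split.
  apply: toCK; rewrite toC_Zising_one_edge; have -> : toC (mkC x 0) = x%:C by [].
  move/(congr1 (real_complex R)): px.
  by rewrite rmorphD !rmorphM !rmorphD !rmorphXn /= rmorphN rmorphD !rmorph1.
rewrite /Cnorm2 /= !RealsE mulr0 addr0 => xx.
have x1' : x = 1 by nra.
by move: p1; rewrite pE -x1' x1' in px *; rewrite px oppr0 ltxx.
Qed.

(** The polynomial is $\lambda^2 + 2b\lambda + 1$; for $b > 1$ its roots are real and distinct with
    product 1. *)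
Lemma exists_off_circle_high b : 1 < b ->
  exists lam, Zising [set [set: 'I_2]] b lam = C0 /\ Cnorm2 lam <> 1.
Proof.
move=> b1; have [r er] : exists r, r ^+ 2 + 2 * b * r + 1 = 0.
  exists (- b + Num.sqrt (b ^+ 2 - 1)).
  have : Num.sqrt (b ^+ 2 - 1) ^+ 2 = b ^+ 2 - 1 by rewrite sqr_sqrtr //; nra.
  by move=> h; lra.
exists (mkC r 0); split.
  apply: toCK; rewrite toC_Zising_one_edge; have -> : toC (mkC r 0) = r%:C by [].
  move/(congr1 (real_complex R)): er.
  rewrite !rmorphD rmorphXn !rmorphM /= rmorph1 rmorph_nat => er'.
  by rewrite -[RHS]er'; ring.
rewrite /Cnorm2 /= !RealsE mulr0 addr0 => rr.
have rb : b * r = - 1 by lra.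
have : b ^+ 2 * (r * r) = 1 by rewrite expr2 mulrACA rb; ring.
by rewrite rr; nra.
Qed.

End Converse.

(** * The range of the edge activity, without division *)

Lemma beta_rangeP K (b : R) : (2 <= K)%N ->
  (Rle (beta_lo K.+1) b /\ Rle b (beta_hi K.+1)) <->
  (b * (neg_bound K + 1) <= 1 /\ - b * (2 ^+ K - 1) <= 1).
Proof.
move=> K2; have M0 := neg_bound_ge0 K2.
have M1 : 0 < neg_bound K + 1 by lra.
have K1 : (0 : R) < 2 ^+ K - 1 by rewrite subr_gt0 exprn_egt1 ?ltr1n // -lt0n ltnW.
have -> : beta_hi K.+1 = (neg_bound K + 1)^-1.
  by rewrite /beta_hi subn1 succnK RinvE RplusE RmultE !RpowE /neg_bound exprMn.
have -> : beta_lo K.+1 = - (2 ^+ K - 1)^-1.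
  by rewrite /beta_lo subn1 succnK RoppE RinvE RminusE RpowE.
rewrite -[b * _ <= 1]ler_pdivlMr // -[- b * _ <= 1]ler_pdivlMr // !mul1r lerNl.
split=> [[/RleP lo /RleP hi]|[/RleP hi /RleP lo]]; by split.
Qed.

Lemma exists_off_circle K (b : R) : (2 <= K)%N -> b <> 1 ->
  ~ (Rle (beta_lo K.+1) b /\ Rle b (beta_hi K.+1)) ->
  exists n, (n <= K)%N /\ exists lam,
    Zising [set [set: 'I_n.+1]] b lam = C0 /\ Cnorm2 lam <> 1.
Proof.
move=> K2 b1; rewrite beta_rangeP // => nrange.
have [lo|lo] := lerP (- b * (2 ^+ K - 1)) 1; last first.
  by exists K; split=> //; apply: exists_off_circle_low lo; apply: ltnW.
have [hi|hi] := lerP (b * (neg_bound K + 1)) 1; first by case: nrange.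
have [b_gt1|b_le1] := ltP 1 b.
  by exists 1%N; split; [apply: ltnW | apply: exists_off_circle_high].
have {b_le1}b1 : b < 1 by rewrite lt_neqAle b_le1 andbT; apply/eqP.
exists K; split=> //; apply: (@exists_off_circle_mid b K _ b1 hi).
(* For [K = 2] there is no gap below 1: [neg_bound] vanishes and [hi] reads $1 < b$. *)
move: K2; rewrite leq_eqVlt => /predU1P[eK|//].
by move: hi; rewrite -eK /neg_bound cos_PI_div_2 mulr0 expr0n /=; lra.
Qed.

(* Imported again so that [%R] below delimits [R_scope], not [ring_scope]. *)
From mathcomp Require Import all_boot.
From Stdlib Require Import Reals.
Local Close Scope complex_scope.
Local Close Scope ring_scope.

Theorem theorem1p2 :
  (forall (k : nat), (3 <= k)%N ->
   forall (n : nat) (E : {set {set 'I_n}}),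
     (forall e, e \in E -> (2 <= #|e| <= k)%N) ->
   forall beta : R, (beta_lo k <= beta <= beta_hi k)%R ->
   forall lam : Cplx, Zising E beta lam = C0 -> Cnorm2 lam = 1%R)
  /\
  (forall (k : nat), (3 <= k)%N ->
   forall beta : R, beta <> 1%R -> ~ (beta_lo k <= beta <= beta_hi k)%R ->
   exists (n : nat) (E : {set {set 'I_n}}),
     (forall e, e \in E -> (#|e| <= k)%N) /\
     exists lam : Cplx, Zising E beta lam = C0 /\ Cnorm2 lam <> 1%R).
Proof.
split=> [k k3 n E cardE|k k3].
  case: k k3 cardE => // K K2 cardE b /(beta_rangeP b K2) [hi lo] lam.
  exact: Zising_zero_on_circle K2 cardE hi lo.
case: k k3 => // K K2 b b1 /(exists_off_circle K2 b1) [n [nK off]].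
exists n.+1, [set [set: 'I_n.+1]]; split=> // e /set1P->.
by rewrite cardsT card_ord.
Qed.
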